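(* Let $r\ge 1$, $N\ge 2$ and $a:\mathbb{N}\to\,]0,+\infty[$. For each proper divisor $s$ of $N$, with $N=ns$, let $a_s(x)=C^{(a)}_{s,x}$ for $x\in\mathbb{N}$, and let $p_n=I_s(P)\in\mathcal{P}(A_{n,r})$, where $P$ is the $\mathcal{M}^{(a)}_{N,r}$-model (so that $p_n$ is a member of the class $\mathcal{I}_{\mathcal{M}^{(a)}}$). Then the distributions $p_n$ are scale-consistent solutions of the maximum entropy problem. That is: (i) for each such $n=N/s$ there is a real constant $c_n$ such that $p_n$ is the (unique) solution $p^*_n$ of the problem: maximize $-\sum_{\mathbf{x}\in A_{n,r}}p(\mathbf{x})\log p(\mathbf{x})$ over $p:A_{n,r}\to\mathbb{R}$ subject to $p(\mathbf{x})\ge 0$ for every $\mathbf{x}\in A_{n,r}$, $\sum_{\mathbf{x}\in A_{n,r}}p(\mathbf{x})=1$ and $\sum_{\mathbf{x}\in A_{n,r}}\log\big(\prod_{j=1}^n a_s(x_j)\big)p(\mathbf{x})=c_n$; (ii) whenever $n_1=N/s_1$ and $n_2=N/s_2$ are two such scales with $n_1$ a multiple of $n_2$, and $\lambda:A_{n_1,r}\to A_{n_2,r}$ is the scale transformation, one has $$p^*_{n_1}\circ\lambda^{-1}=p^*_{n_2}.$$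
   Context: $\mathbb{N}=\{0,1,2,\dots\}$. For integers $m\ge 1$, $r\ge 0$ let $A_{m,r}=\{\mathbf{x}=(x_1,\dots,x_m): x_j\in\{0,1,\dots,r\},\ \sum_{j=1}^m x_j=r\}$, and let $\mathcal{P}(A_{m,r})$ be the set of probability distributions on $A_{m,r}$. For $a:\mathbb{N}\to\,]0,+\infty[$, put $C^{(a)}_{m,r}=\sum_{\boldsymbol{\eta}\in A_{m,r}}\prod_{j=1}^m a(\eta_j)$. The $\mathcal{M}^{(a)}_{m,r}$-model is the probability distribution on $A_{m,r}$ given by $P(\mathbf{x})=\prod_{j=1}^m a(x_j)\big/C^{(a)}_{m,r}$. Merging transformation: let $s$ be a proper divisor of $M$ ($s\neq M$), $M=ms$. Given $P\in\mathcal{P}(A_{M,r})$, write the occupancy numbers in consecutive groups of size $s$ as $(Z_{1,1},\dots,Z_{1,s},\dots,Z_{m,1},\dots,Z_{m,s})\sim P$. Then $I_s(P)\in\mathcal{P}(A_{m,r})$ is the law of $(X_1,\dots,X_m)$, where $X_j=\sum_{h=1}^s Z_{j,h}$. The class $\mathcal{I}_{\mathcal{M}^{(a)}}$ consists of the models of the form $I_s(P)$ for some $s$ and some $P$ of type $\mathcal{M}^{(a)}$. Scale transformation: if $n_1=n_2t$, $\lambda:A_{n_1,r}\to A_{n_2,r}$ sums consecutive blocks of $t$ cells, $\lambda(\mathbf{x})_j=\sum_{h=1}^t x_{(j-1)t+h}$ for $j=1,\dots,n_2$; $p\circ\lambda^{-1}$ denotes the push-forward of $p$ under $\lambda$. A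 family of maximum entropy solutions is scale-consistent if $p^*_{n_1}\circ\lambda^{-1}=p^*_{n_2}$, where $p^*_{n_1},p^*_{n_2}$ are the solutions at scales $n_1,n_2$. The convention $0\log 0=0$ is used. *)

(* Defs.v *)
From HB Require Import structures.
From mathcomp Require Import all_boot all_order all_algebra.
From mathcomp Require Import reals exp.

Set Implicit Arguments.
Unset Strict Implicit.
Unset Printing Implicit Defensive.

Import Order.TTheory GRing.Theory Num.Theory.
Local Open Scope ring_scope.

(* A_{m,r} as a finite type; cells are numbered 0, ..., m - 1. *)
Record occ (m r : nat) : predArgType := Occ {
  occ_val :> {ffun 'I_m -> 'I_r.+1};
  _ : (\sum_(j < m) occ_val j == r)%N
}.
HB.instance Definition _ (m r : nat) := [isSub for @occ_val m r].
HB.instance Definition _ (m r : nat) := [Finite of occ m r by <:].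

Lemma occ_sum (m r : nat) (x : occ m r) : (\sum_(j < m) x j)%N = r.
Proof. by case: x => v /= /eqP. Qed.

(* C^{(a)}_{m,r}; in particular a_s is the partial application [partfun a s]. *)
Definition partfun (R : realType) (a : nat -> R) (m r : nat) : R :=
  \sum_(eta : occ m r) \prod_(j < m) a (eta j).

(* The M^{(a)}_{m,r}-model. *)
Definition model (R : realType) (a : nat -> R) (m r : nat) :
    {ffun occ m r -> R} :=
  [ffun x : occ m r => (\prod_(j < m) a (x j)) / partfun a m r].

Definition block (M r s : nat) (x : occ M r) (j : nat) : nat :=
  (\sum_(i < M | (j * s <= i < j.+1 * s)%N) x i)%N.

Lemma sum_block (M m s r : nat) (e : M = (m * s)%N) (x : occ M r) :
  (\sum_(j < m) block s x j)%N = r.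
Proof.
rewrite -[RHS](occ_sum x) /block (exchange_big_dep xpredT) //=.
apply: eq_bigr => i _.
have lt_i : (i < m * s)%N by rewrite -e.
have s_gt0 : (0 < s)%N by case: s lt_i {e} => //; rewrite muln0.
have lt_q : (i %/ s < m)%N by rewrite ltn_divLR.
rewrite (big_pred1 (Ordinal lt_q)) // => j /=.
by rewrite -leq_divRL // -ltn_divLR // ltnS -eqn_leq -val_eqE.
Qed.

Lemma block_lt (M m s r : nat) (e : M = (m * s)%N) (x : occ M r) (j : 'I_m) :
  (block s x j < r.+1)%N.
Proof. by rewrite ltnS -{2}(sum_block e x) (bigD1 j) //= leq_addr. Qed.

Definition block_fun (M m s r : nat) (e : M = (m * s)%N) (x : occ M r) :
    {ffun 'I_m -> 'I_r.+1} :=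
  [ffun j => Ordinal (block_lt e x j)].

Lemma block_fun_sum (M m s r : nat) (e : M = (m * s)%N) (x : occ M r) :
  (\sum_(j < m) block_fun e x j == r)%N.
Proof.
by under eq_bigr do rewrite ffunE; rewrite /= (sum_block e).
Qed.

(* Sums consecutive blocks of s cells when M = m * s: this is both the map
   Z |-> X underlying I_s and, for (M, m, s) = (n_1, n_2, t), the scale
   transformation lambda. *)
Definition block_sum (M m s r : nat) (e : M = (m * s)%N) (x : occ M r) :
    occ m r :=
  Occ (block_fun_sum e x).

Definition pushforward (R : realType) (T U : finType) (f : T -> U)
    (p : {ffun T -> R}) : {ffun U -> R} :=
  [ffun y => \sum_(x : T | f x == y) p x].

(* I_s(P), where M = m * s. *)
Definition merging (R : realType) (M m s r : nat) (e : M = (m * s)%N)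
    (P : {ffun occ M r -> R}) : {ffun occ m r -> R} :=
  pushforward (block_sum e) P.

(* [ln 0] is a real number, so 0 * ln 0 = 0. *)
Definition entropy (R : realType) (T : finType) (p : {ffun T -> R}) : R :=
  - \sum_(x : T) p x * ln (p x).

Definition feasible (R : realType) (n r : nat) (b : nat -> R) (c : R)
    (p : {ffun occ n r -> R}) : Prop :=
  [/\ forall x, 0 <= p x,
      \sum_(x : occ n r) p x = 1
    & \sum_(x : occ n r) ln (\prod_(j < n) b (x j)) * p x = c].

Definition maxent_solution (R : realType) (n r : nat) (b : nat -> R) (c : R)
    (p : {ffun occ n r -> R}) : Prop :=
  feasible b c p /\
  forall q : {ffun occ n r -> R}, feasible b c q -> entropy q <= entropy p.

(* Main.v *)
Require Import Defs.
From mathcomp Require Import all_boot all_order all_algebra.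
From mathcomp Require Import reals exp.
From mathcomp Require Import sequences ring lra.

Set Implicit Arguments.
Unset Strict Implicit.
Unset Printing Implicit Defensive.

Import Order.TTheory GRing.Theory Num.Theory.
Local Open Scope ring_scope.

(* Grouping the [N] cells into blocks, a product over cells becomes a product of
   block products, so summing over the fibre of [block_sum] factorises: merging
   the M^(a)-model gives the M^(a_s)-model. Such a model is an exponential
   family [p x = exp (E x) / Z], [E] being the constrained observable, hence by
   Gibbs' inequality it is the unique entropy maximiser under its own mean of
   [E]. Scale consistency is the fact that summing blocks of blocks is summing
   larger blocks. *)

(** * Gibbs' inequality with its equality case *)

(** For [q > 0] this is [1 + u <= expR u] at [u = ln p - ln q], multiplied by [q]; strictness for
    [u != 0] gives the equality case, on which uniqueness of the maximiser rests. *)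
Lemma gibbs_term (R : realType) (p q : R) : 0 < p -> 0 <= q ->
  q * (ln p - ln q) <= p - q ?= iff (q == p).
Proof.
move=> p_gt0; rewrite le_eqVlt => /predU1P[<-|q_gt0].
  (* At [q = 0] the factor [q] kills the logarithms, whatever the value of [ln 0]. *)
  by rewrite mul0r subr0; split; [exact: ltW|rewrite eq_sym].
have [->|neq] := eqVneq q p; first by split; rewrite !subrr mulr0 ?eqxx.
set u := ln p - ln q.
have u_neq0 : u != 0.
  rewrite subr_eq0; apply: contraNneq neq => eq_ln.
  by apply/eqP; apply: ln_inj; rewrite ?posrE.
have eu : expR u = p / q by rewrite expRB !lnK ?posrE.
have lt_u : q * u < p - q.
  by have := expR_gt1Dx u_neq0; rewrite eu ltr_pdivlMr // mulrDl; lra.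
by split; [exact: ltW|rewrite lt_eqF].
Qed.

Lemma gibbs (R : realType) (T : finType) (p q : {ffun T -> R}) :
  (forall x, 0 < p x) -> (forall x, 0 <= q x) ->
  \sum_x p x = 1 -> \sum_x q x = 1 ->
  entropy q <= - \sum_x q x * ln (p x) ?= iff (q == p).
Proof.
move=> p_gt0 q_ge0 sp sq.
have := leif_sum (P := xpredT) (fun x _ => gibbs_term (p_gt0 x) (q_ge0 x)).
rewrite [X in _ <= X ?= iff _]big_split /= sumrN sp sq subrr.
under eq_bigr do rewrite mulrBr.
rewrite big_split /= sumrN /entropy => -[le0 eq0]; split; first by lra.
have -> : (q == p) = [forall x, q x == p x].
  by apply/eqP/eqfunP => [-> //|/ffunP].
by rewrite -eq0 -subr_eq0; congr (_ == 0); ring.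
Qed.

(** * Cells indexed by block and position in the block *)

Section Cells.
Variables (n s : nat).

Lemma cell_subproof (j : 'I_n) (h : 'I_s) : (j * s + h < n * s)%N.
Proof.
apply: (@leq_trans (j.+1 * s)); last by rewrite leq_mul2r ltn_ord orbT.
by rewrite mulSn addnC ltn_add2r.
Qed.

Definition cell (j : 'I_n) (h : 'I_s) : 'I_(n * s) :=
  Ordinal (cell_subproof j h).

Lemma cell_div (j : 'I_n) (h : 'I_s) : (cell j h %/ s)%N = j.
Proof.
have s_gt0 : (0 < s)%N by apply: leq_trans (ltn_ord h).
by rewrite /= divnMDl // divn_small ?addn0.
Qed.

Lemma cell_mod (j : 'I_n) (h : 'I_s) : (cell j h %% s)%N = h.
Proof. by rewrite /= modnMDl modn_small. Qed.

Lemma cell_of_subproof (i : 'I_(n * s)) : (i %/ s < n)%N && (i %% s < s)%N.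
Proof.
have s_gt0 : (0 < s)%N by case: (s) i => [[i]|//]; rewrite muln0.
by rewrite ltn_divLR // ltn_ord ltn_mod.
Qed.

Definition cell_row (i : 'I_(n * s)) : 'I_n :=
  Ordinal (proj1 (andP (cell_of_subproof i))).

Definition cell_col (i : 'I_(n * s)) : 'I_s :=
  Ordinal (proj2 (andP (cell_of_subproof i))).

Lemma cellK (i : 'I_(n * s)) : cell (cell_row i) (cell_col i) = i.
Proof. by apply: val_inj; rewrite /= -divn_eq. Qed.

Lemma cell_rowK (j : 'I_n) (h : 'I_s) : cell_row (cell j h) = j.
Proof. by apply: val_inj; rewrite -[RHS](cell_div j h). Qed.

Lemma cell_colK (j : 'I_n) (h : 'I_s) : cell_col (cell j h) = h.
Proof. by apply: val_inj; rewrite -[RHS](cell_mod j h). Qed.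

(** Euclidean division by [s] gives the bijection between cells and pairs (block, position). *)
Lemma big_cell (T : Type) (idx : T) (op : Monoid.com_law idx)
    (F : 'I_(n * s) -> T) :
  \big[op/idx]_i F i = \big[op/idx]_(j < n) \big[op/idx]_(h < s) F (cell j h).
Proof.
rewrite pair_big /= (reindex (fun p => cell p.1 p.2)) //=.
exists (fun i => (cell_row i, cell_col i)) => [[j h] _|i _] /=.
  by rewrite cell_rowK cell_colK.
exact: cellK.
Qed.

End Cells.

(** * Block totals and the merged model *)

Lemma block_cond (M s j : nat) (i : 'I_M) :
  (0 < s)%N -> (j * s <= i < j.+1 * s)%N = (i %/ s == j)%N.
Proof. by move=> s_gt0; rewrite -leq_divRL // -ltn_divLR // ltnS eq_sym eqn_leq. Qed.

Lemma block_cell (n s r : nat) (x : occ (n * s) r) (j : 'I_n) :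
  block s x j = (\sum_(h < s) x (cell j h))%N.
Proof.
rewrite /block big_mkcond big_cell (bigD1 j) //= [X in (_ + X)%N]big1 ?addn0.
  apply: eq_bigr => h _.
  by rewrite (block_cond j (cell j h)) ?cell_div ?eqxx ?(leq_trans _ (ltn_ord h)).
move=> k neq; apply: big1 => h _.
rewrite (block_cond j (cell k h)) ?cell_div ?(leq_trans _ (ltn_ord h)) //.
by rewrite (inj_eq val_inj) (negbTE neq).
Qed.

Lemma block_sum_eqP (M m s r : nat) (e : M = (m * s)%N) (x : occ M r)
    (y : occ m r) :
  reflect (forall j : 'I_m, block s x j = y j) (block_sum e x == y).
Proof.
apply: (iffP eqP) => [<- j|eq_xy]; first by rewrite ffunE.
by apply/val_inj/ffunP => j; apply: val_inj; rewrite ffunE /= eq_xy.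
Qed.

(* The occupancy numbers counted by [partfun a s k] have type ['I_k.+1]; here
   they are all moved to one type ['I_r.+1], independent of [k]. *)
Lemma partfun_ffun (R : realType) (a : nat -> R) (s k r : nat) : (k <= r)%N ->
  partfun a s k =
    \sum_(f : {ffun 'I_s -> 'I_r.+1} | (\sum_h f h == k)%N) \prod_h a (f h).
Proof.
move=> le_kr.
pose w (eta : occ s k) : {ffun 'I_s -> 'I_r.+1} :=
  [ffun h => widen_ord (le_kr : (k < r.+1)%N) (eta h)].
(* The partial inverse may do anything off the summation range; on it every [f h] is at most the
   total [k], so [inord] keeps its value. *)
pose w' (f : {ffun 'I_s -> 'I_r.+1}) : option (occ s k) :=
  insub [ffun h => inord (f h)].
have w'K eta : w' (w eta) = Some eta.
  rewrite /w' -[RHS](valK eta); congr insub.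
  by apply/ffunP => h; apply: val_inj; rewrite !ffunE /= inordK.
rewrite (reindex_omap w w') /=; last first.
  move=> f /eqP sf.
  have le_fk h : (f h < k.+1)%N by rewrite ltnS -sf (bigD1 h) //= leq_addr.
  rewrite /w'; case: insubP => [eta _ def|/negP[]] /=.
    congr Some; apply/ffunP => h; apply: val_inj.
    by rewrite ffunE /= def ffunE inordK.
  by apply/eqP; rewrite -[RHS]sf; apply: eq_bigr => h _; rewrite ffunE inordK.
apply: eq_big => [eta|eta _].
  rewrite w'K eqxx andbT; apply/esym/eqP; rewrite -[RHS](occ_sum eta).
  by apply: eq_bigr => h _; rewrite ffunE.
by apply: eq_bigr => h _; rewrite ffunE.
Qed.

Lemma sum_block_fibre (R : realType) (a : nat -> R) (M n s r : nat)
    (e : M = (n * s)%N) (y : occ n r) :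
  \sum_(x : occ M r | block_sum e x == y) \prod_i a (x i) =
    \prod_(j < n) partfun a s (y j).
Proof.
subst M.
(* Distributivity needs one index type for all blocks, although their totals [y j] differ. The
   resulting families of block contents correspond to the points of the fibre by cutting [x] into
   blocks. *)
rewrite [RHS](eq_bigr _ (fun j _ => partfun_ffun a s (leq_ord (y j)))).
rewrite bigA_distr_big_dep /=.
pose w (x : occ (n * s) r) : {ffun 'I_n -> {ffun 'I_s -> 'I_r.+1}} :=
  [ffun j => [ffun h => x (cell j h)]].
pose w' (g : {ffun 'I_n -> {ffun 'I_s -> 'I_r.+1}}) : option (occ (n * s) r) :=
  insub [ffun i => g (cell_row i) (cell_col i)].
have w'K x : w' (w x) = Some x.
  rewrite /w' -[RHS](valK x); congr insub.
  by apply/ffunP => i; rewrite !ffunE cellK.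
rewrite [RHS](reindex_omap w w') /=; last first.
  move=> g /familyP gy; rewrite /w'; case: insubP => [x _ def|/negP[]] /=.
    congr Some; apply/ffunP => j; apply/ffunP => h.
    by rewrite !ffunE def ffunE cell_rowK cell_colK.
  apply/eqP; rewrite big_cell /= -[RHS](occ_sum y).
  apply: eq_bigr => j _; rewrite -(eqP (gy j)).
  by apply: eq_bigr => h _; rewrite ffunE cell_rowK cell_colK.
apply: eq_big => [x|x _].
  rewrite w'K eqxx andbT.
  have sumE j : (\sum_h w x j h)%N = block s x j.
    by rewrite block_cell; apply: eq_bigr => h _; rewrite !ffunE.
  apply/block_sum_eqP/familyP => xy j.
    by rewrite unfold_in sumE xy.
  by rewrite -sumE; apply/eqP/xy.
rewrite big_cell; apply: eq_bigr => j _.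
by apply: eq_bigr => h _; rewrite !ffunE.
Qed.

(** Partitioning the configurations by their block totals shows that merging preserves the
    normalising constant. *)
Lemma partfun_partfun (R : realType) (a : nat -> R) (M n s r : nat)
    (e : M = (n * s)%N) : partfun (partfun a s) n r = partfun a M r.
Proof.
rewrite [RHS]/partfun (partition_big (block_sum e) xpredT) //=.
by apply: eq_bigr => y _; rewrite sum_block_fibre.
Qed.

Lemma merging_model (R : realType) (a : nat -> R) (M n s r : nat)
    (e : M = (n * s)%N) :
  merging e (model a M r) = model (partfun a s) n r.
Proof.
apply/ffunP => y; rewrite !ffunE (partfun_partfun _ _ e) -(sum_block_fibre _ e).
by rewrite mulr_suml; apply: eq_bigr => x _; rewrite ffunE.
Qed.

(** * Scale consistency of merging *)

Lemma pushforward_block_sum (R : realType) (M n1 s1 n2 s2 t r : nat)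
    (e1 : M = (n1 * s1)%N) (e2 : M = (n2 * s2)%N) (e : n1 = (n2 * t)%N)
    (P : {ffun occ M r -> R}) : (0 < M)%N ->
  pushforward (block_sum e) (merging e1 P) = merging e2 P.
Proof.
move=> M_gt0.
have s1_gt0 : (0 < s1)%N by move: M_gt0; rewrite e1 muln_gt0 => /andP[].
have n1_gt0 : (0 < n1)%N by move: M_gt0; rewrite e1 muln_gt0 => /andP[].
have n2_gt0 : (0 < n2)%N by move: M_gt0; rewrite e2 muln_gt0 => /andP[].
have t_gt0 : (0 < t)%N by move: n1_gt0; rewrite e muln_gt0 => /andP[].
have s2E : s2 = (s1 * t)%N.
  by apply/eqP; rewrite -(eqn_pmul2l n2_gt0) -e2 e1 e mulnAC mulnA.
have s2_gt0 : (0 < s2)%N by rewrite s2E muln_gt0 s1_gt0.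
have comp x : block_sum e (block_sum e1 x) = block_sum e2 x.
  apply/eqP/block_sum_eqP => j; rewrite ffunE /= /block.
  under eq_bigr => i _ do rewrite ffunE /= /block.
  (* A cell [k] lies in exactly one block of size [s1], number [k %/ s1], and
     [k %/ s1 %/ t = k %/ s2]. *)
  rewrite (exchange_big_dep (fun k : 'I_M => k %/ s2 == j)%N) /=; last first.
    move=> i k; rewrite !block_cond // => /eqP <- /eqP <-.
    by rewrite -divnMA s2E.
  apply: eq_big => [k|k /eqP kj]; first by rewrite block_cond.
  have lt_k : (k %/ s1 < n1)%N by rewrite ltn_divLR // -e1.
  rewrite (big_pred1 (Ordinal lt_k)) // => i /=.
  rewrite !block_cond // -val_eqE /= [RHS]eq_sym andbC.
  by case: eqP => //= <-; rewrite -divnMA -s2E kj eqxx.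
apply/ffunP => z; rewrite !ffunE.
under eq_bigr do rewrite ffunE.
rewrite (exchange_big_dep (fun x => block_sum e2 x == z)) /=; last first.
  by move=> y x /eqP <- /eqP <-; rewrite comp.
apply: eq_bigr => x /eqP xz.
rewrite (big_pred1 (block_sum e1 x)) // => y /=.
by rewrite andbC [RHS]eq_sym; case: eqP => //= <-; rewrite comp xz eqxx.
Qed.

(** * Models as maximum entropy solutions *)

Section Positivity.
Variables (R : realType) (b : nat -> R) (b_gt0 : forall k, 0 < b k).

Lemma prod_gt0 (n r : nat) (x : occ n r) : 0 < \prod_(j < n) b (x j).
Proof. by apply: prodr_gt0 => j _. Qed.

Lemma partfun_gt0 (n r : nat) : (0 < n)%N -> 0 < partfun b n r.
Proof.
case: n => // n _.
(* All [r] in the first cell: a configuration exists, so the sum has a positive term. *)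
pose f : {ffun 'I_n.+1 -> 'I_r.+1} :=
  [ffun j => if j == ord0 then ord_max else ord0].
have sf : (\sum_j f j == r)%N.
  rewrite (bigD1 ord0) //= big1 ?ffunE ?addn0 // => j /negbTE j0.
  by rewrite ffunE j0.
rewrite /partfun (bigD1 (Occ sf)) //= ltr_pwDl //.
  exact: (prod_gt0 (Occ sf)).
by apply: sumr_ge0 => x _; rewrite ltW ?prod_gt0.
Qed.

Lemma model_gt0 (n r : nat) (x : occ n r) : (0 < n)%N -> 0 < model b n r x.
Proof. by move=> n_gt0; rewrite ffunE divr_gt0 ?prod_gt0 ?partfun_gt0. Qed.

Lemma sum_model (n r : nat) : (0 < n)%N -> \sum_x model b n r x = 1.
Proof.
move=> n_gt0; under eq_bigr do rewrite ffunE.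
by rewrite -mulr_suml divff ?gt_eqF ?partfun_gt0.
Qed.

(** The logarithm of the model is the constrained observable minus a constant, so the cross entropy
    takes the same value at every feasible [q], the model included. This turns the Gibbs bound into
    a bound by the entropy of the model. *)
Lemma cross_entropy_model (n r : nat) (c : R) (q : {ffun occ n r -> R}) :
  (0 < n)%N -> feasible b c q ->
  - \sum_x q x * ln (model b n r x) = ln (partfun b n r) - c.
Proof.
move=> n_gt0 [_ sq <-].
under eq_bigr => x _ do
  rewrite ffunE ln_div ?posrE ?prod_gt0 ?partfun_gt0 // mulrBr mulrC.
by rewrite sumrB -mulr_suml sq; ring.
Qed.

Lemma maxent_model (n r : nat) : (0 < n)%N ->
  unique (maxent_solution b
            (\sum_(x : occ n r) ln (\prod_(j < n) b (x j)) * model b n r x))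
         (model b n r).
Proof.
move=> n_gt0; set c := \sum_x _.
have fp : feasible b c (model b n r).
  by split=> // [x|]; rewrite ?ltW ?model_gt0 ?sum_model.
have gibbs_p q : feasible b c q ->
    entropy q <= entropy (model b n r) ?= iff (q == model b n r).
  move=> fq; have [q_ge0 sq _] := fq.
  rewrite [entropy (model b n r)]/entropy (cross_entropy_model n_gt0 fp).
  rewrite -(cross_entropy_model n_gt0 fq); apply: gibbs => // [x|].
    exact: model_gt0.
  exact: sum_model.
split=> [|q [fq max_q]]; first by split=> // q /gibbs_p[].
(* Two maximisers have equal entropy, which is the equality case of Gibbs. *)
by apply/esym/eqP; rewrite -(gibbs_p q fq) eq_le max_q // gibbs_p.
Qed.

End Positivity.

Theorem proposition4p3 (R : realType) (r N : nat) (a : nat -> R)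
    (hr : (1 <= r)%N) (hN : (2 <= N)%N) (ha : forall k : nat, 0 < a k) :
  exists c : nat -> R,
    (forall (n s : nat) (e : N = (n * s)%N), s <> N ->
       unique (@maxent_solution R n r (partfun a s) (c n))
              (merging e (model a N r)))
    /\
    (forall (n1 s1 n2 s2 t : nat) (e1 : N = (n1 * s1)%N)
        (e2 : N = (n2 * s2)%N) (e : n1 = (n2 * t)%N)
        (p1 : {ffun occ n1 r -> R}) (p2 : {ffun occ n2 r -> R}),
       s1 <> N -> s2 <> N ->
       maxent_solution (partfun a s1) (c n1) p1 ->
       maxent_solution (partfun a s2) (c n2) p2 ->
       pushforward (block_sum e) p1 = p2).
Proof.
have N_gt0 : (0 < N)%N by apply: leq_trans hN.
(* The constant [c] may depend on [n] only, so the block size is recovered as [N %/ n]. *)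
pose b n := partfun a (N %/ n)%N.
pose c n :=
  \sum_(x : occ n r) ln (\prod_(j < n) b n (x j)) * model (b n) n r x.
exists c.
have uniq_p n s (e : N = (n * s)%N) :
    unique (@maxent_solution R n r (partfun a s) (c n))
           (merging e (model a N r)).
  have /andP[n_gt0 s_gt0] : (0 < n)%N && (0 < s)%N by rewrite -muln_gt0 -e.
  have bE : b n = partfun a s by rewrite /b e mulKn.
  rewrite merging_model /c bE; apply: maxent_model => // k.
  exact: partfun_gt0.
split=> [n s e _|n1 s1 n2 s2 t e1 e2 e p1 p2 _ _ sol1 sol2]; first exact: uniq_p.
(* By uniqueness both solutions are mergings of the same model on [N] cells. *)
rewrite -((uniq_p _ _ e1).2 _ sol1) -((uniq_p _ _ e2).2 _ sol2).
exact: pushforward_block_sum.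
Qed.
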